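(* Let $(X,d)$ be a metric space and let $(x_n)_{n\geq 1}$, $(y_n)_{n\geq 1}$ be two sequences of elements of $X$, both converging to the same point $x^{\ast}\in X$. Then $(x_n)$ converges faster than $(y_n)$ to $x^{\ast}$ (in the sense of Berinde).
   Context: Faster convergence of real sequences: if $(a_n)$ and $(b_n)$ are sequences of real numbers converging to $a$ and $b$ respectively, then $(a_n)$ is said to converge faster to $a$ than $(b_n)$ to $b$ if the limit $\lim_{n\to\infty}\left|\frac{a_n-a}{b_n-b}\right|$ exists and equals $0$. Faster convergence in the sense of Berinde (metric space version): let $(X,d)$ be a metric space and let $(x_n)_{n\ge 1}$, $(y_n)_{n\ge 1}$ be sequences in $X$ both converging to the same point $x^{\ast}\in X$. One says that $(x_n)$ converges faster than $(y_n)$ to $x^{\ast}$ if there exist two sequences $(a_n)_{n\ge 1}$ and $(b_n)_{n\ge 1}$ of positive real numbers, both converging to $0$, such that $d(x_n,x^{\ast})\le a_n$ and $d(y_n,x^{\ast})\le b_n$ for all $n\geq 1$, and $(a_n)$ converges faster to $0$ than $(b_n)$ to $0$, i.e. $\lim_{n\to\infty} a_n/b_n=0$. *)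

(* Defs.v *)
From HB Require Import structures.
From mathcomp Require Export all_boot all_order all_algebra.
From mathcomp Require Export all_classical all_reals all_analysis.
Export Order.TTheory GRing.Theory Num.Theory.
Export numFieldNormedType.Exports.

Global Set Implicit Arguments.
Global Unset Strict Implicit.
Global Unset Printing Implicit Defensive.

Global Open Scope classical_set_scope.
Global Open Scope ring_scope.

(* Meant for [u] converging to [a] and [v] converging to [b].  Since division
   by 0 is total, that the quotients are eventually defined has to be
   required explicitly. *)
Definition converges_faster_real (R : realType)
    (u : nat -> R) (a : R) (v : nat -> R) (b : R) : Prop :=
  (\forall n \near \oo, v n != b) /\
  `| (u n - a) / (v n - b) | @[n --> \oo] --> (0 : R).

(* Meant for [x] and [y] converging to [xstar].  Sequences are indexed by
   n >= 1: the value at 0 of a function on [nat] is unconstrained. *)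
Definition converges_faster_Berinde (R : realType) (X : metricType R)
    (x y : nat -> X) (xstar : X) : Prop :=
  exists a b : nat -> R,
    [/\ forall n, (1 <= n)%N -> 0 < a n /\ 0 < b n,
        a @ \oo --> (0 : R) /\ b @ \oo --> (0 : R),
        forall n, (1 <= n)%N -> mdist (x n) xstar <= a n,
        forall n, (1 <= n)%N -> mdist (y n) xstar <= b n
      & converges_faster_real a 0 b 0].

(* Main.v *)
Require Import Defs.

(** The sense of Berinde only asks for upper bounds of the two distances, so
    either bound may be taken much larger than the distance that it controls.
    Let [a n] be [mdist (x n) xstar] plus a positive null sequence, and let
    [b n] be [mdist (y n) xstar + Num.sqrt (a n)].  Both are positive and tend
    to 0, and since [b n] dominates [Num.sqrt (a n)], the quotient [a n / b n]
    is at most [Num.sqrt (a n)], which tends to 0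
    ([div_add_sqrt_le] and [cvg0_sqrt]).  Nothing relates the speeds of
    [x] and [y]: exchanging their roles gives the opposite comparison. *)

Lemma cvg_mdist0 (R : realType) (X : metricType R) (x : nat -> X) (l : X) :
  x @ \oo --> l -> mdist (x n) l @[n --> \oo] --> (0 : R).
Proof.
move=> xl; apply/(@cvgr0Pnorm_lt R R^o) => e e0.
apply: filterS (metricType_numDomainType.cvgr_dist_lt xl e0) => n.
by rewrite metric_sym ger0_norm// mdist_ge0.
Qed.

Lemma cvg0_sqrt (R : realType) (u : nat -> R) :
  u @ \oo --> (0 : R) -> Num.sqrt (u n) @[n --> \oo] --> (0 : R).
Proof.
move=> u0; rewrite -[X in _ --> X]sqrtr0.
exact: (cvg_comp _ _ u0 (@sqrt_continuous R 0)).
Qed.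

(** Adding [Num.sqrt a] to the denominator suffices because
    [a / Num.sqrt a = Num.sqrt a]. *)
Lemma div_add_sqrt_le (R : realType) (a d : R) :
  0 < a -> 0 <= d -> a / (d + Num.sqrt a) <= Num.sqrt a.
Proof.
move=> a0 d0; have s0 : 0 < Num.sqrt a by rewrite sqrtr_gt0.
rewrite ler_pdivrMr; last by rewrite ltr_wpDl.
by rewrite mulrDr -expr2 (sqr_sqrtr (ltW a0)) lerDr mulr_ge0// ltW.
Qed.

Theorem proposition1 (R : realType) (X : metricType R) (x y : nat -> X)
    (xstar : X) (hx : x @ \oo --> xstar) (hy : y @ \oo --> xstar) :
  converges_faster_Berinde x y xstar.
Proof.
(* The harmonic term keeps [a] positive where [x n = xstar]. *)
pose a n : R := mdist (x n) xstar + harmonic n.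
pose b n : R := mdist (y n) xstar + Num.sqrt (a n).
have a_gt0 n : 0 < a n by rewrite ltr_wpDl ?mdist_ge0// harmonic_gt0.
have b_gt0 n : 0 < b n by rewrite ltr_wpDl ?mdist_ge0// sqrtr_gt0.
have a_cvg0 : a @ \oo --> (0 : R).
  by rewrite -[X in _ --> X]addr0; apply: cvgD (cvg_mdist0 hx) cvg_harmonic.
have sqrta_cvg0 := cvg0_sqrt a_cvg0.
have b_cvg0 : b @ \oo --> (0 : R).
  by rewrite -[X in _ --> X]addr0; apply: cvgD (cvg_mdist0 hy) sqrta_cvg0.
exists a, b; split=> //.
- by move=> n _; rewrite lerDl harmonic_ge0.
- by move=> n _; rewrite lerDl sqrtr_ge0.
- split; first by apply: nearW => n; rewrite gt_eqF.
  apply: (squeeze_cvgr _ (cvg_cst 0) sqrta_cvg0).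
  apply: nearW => n; rewrite normr_ge0 !subr0 ger0_norm; last first.
    by rewrite divr_ge0// ltW.
  exact: div_add_sqrt_le (a_gt0 n) (mdist_ge0 _ _).
Qed.
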